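(* If $G$ is a chordal graph, then its injective hull $\mathcal{H}(G)$ is also chordal.
   Context: Graphs are finite, connected, simple, with shortest-path metric. A graph is chordal if it has no induced cycle of length at least 4. A graph is Helly if every family of pairwise intersecting disks $D(v,r)=\{u:d(u,v)\le r\}$ has a common vertex. The injective hull $\mathcal{H}(G)$ is the unique minimal Helly graph containing $G$ as an isometric subgraph (equivalently, the graph on functions $f:V(G)\to\mathbb{Z}_{\ge0}$ with $f(x)+f(y)\ge d_G(x,y)$ for all $x,y$ and for each $x$ some $y$ with equality, adjacency meaning sup-norm distance 1). *)

(* Defs.v *)
From mathcomp Require Import all_boot all_order all_algebra.
Set Implicit Arguments.
Unset Strict Implicit.
Unset Printing Implicit Defensive.

(* A simple graph is a symmetric irreflexive relation on its vertex type. *)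

Definition connected (V : finType) (E : rel V) : Prop :=
  forall x y, connect E x y.

Definition walk (V : finType) (E : rel V) (n : nat) (x y : V) : bool :=
  [exists p : n.-tuple V, path E x p && (last x p == y)].

(* Shortest-path distance: in a connected graph some walk from x to y has
   length less than #|V|, so [find] returns the least length of a walk. (If
   there is no walk the value is #|V|; only connected graphs are of
   interest here.) *)
Definition dist (V : finType) (E : rel V) (x y : V) : nat :=
  find (fun n => walk E n x y) (iota 0 #|V|).

(* [c] lists the vertices of a cycle of length n, in cyclic order; [ordS] is
   the successor modulo n. The equation says that the edges among these
   vertices are exactly the edges of the cycle. *)
Definition induced_cycle (T : Type) (E : rel T) (n : nat) (c : 'I_n -> T) :=
  injective c /\ forall i j, E (c i) (c j) = (j == ordS i) || (i == ordS j).

Definition chordal (T : Type) (E : rel T) : Prop :=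
  forall (n : nat) (c : 'I_n -> T), 4 <= n -> ~ induced_cycle E c.

(* The witness y may be equal to x. *)
Definition extremal (V : finType) (E : rel V) (f : {ffun V -> nat}) : bool :=
  [forall x, forall y, dist E x y <= f x + f y]
  && [forall x, exists y, f x + f y == dist E x y].

Definition hull_vertex (V : finType) (E : rel V) : Type :=
  {f : {ffun V -> nat} | extremal E f}.

Definition sup_dist (V : finType) (f g : V -> nat) : nat :=
  \max_(x : V) `|f x - g x|%N.

(* The adjacency relation of the injective hull of E. *)
Definition hull_adj (V : finType) (E : rel V) : rel (hull_vertex E) :=
  fun f g => sup_dist (val f) (val g) == 1.

Lemma hull_adj_sym (V : finType) (E : rel V) : symmetric (@hull_adj V E).
Proof.
move=> f g; rewrite /hull_adj /sup_dist; congr (_ == _).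
by apply: eq_bigr => x _; rewrite distnC.
Qed.

Lemma hull_adj_irr (V : finType) (E : rel V) : irreflexive (@hull_adj V E).
Proof.
move=> f; rewrite /hull_adj /sup_dist big1 // => x _.
by rewrite distnn.
Qed.

(* Main.v *)
(** A perfect elimination order of a chordal graph gives a clique tree whose
    nodes are the vertices: the bag of i is i with its earlier neighbours, a
    clique, and the parent of i is its latest earlier neighbour. The nodes whose
    bag meets the disk D(x,r) form a subtree T(x,r), and T(x,r) meets T(y,s) as
    soon as d(x,y) <= r + s + 1. For a hull vertex f, let S(f) be the
    intersection of all T(x,f(x)). By the Helly property of subtrees, f and g
    are at sup-distance at most 1 iff S(f) meets S(g), so the hull is an
    intersection graph of subtrees of a tree. In an induced cycle, the top
    node of the S(f) with latest top also lies in S(g) for both neighbours g of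
    f; hence these neighbours are adjacent and the cycle has length 3. *)
Require Import Defs.
From mathcomp Require Import all_boot all_order all_algebra.
From mathcomp Require Import zify.
Set Implicit Arguments.
Unset Strict Implicit.
Unset Printing Implicit Defensive.

(** * Shortest-path distance in a connected graph *)

Section Distance.
Variables (V : finType) (E : rel V).
Hypotheses (E_sym : symmetric E) (E_conn : connected E).

Lemma dist_leP x y n :
  reflect (exists p, [/\ size p <= n, path E x p & last x p = y])
          (dist E x y <= n).
Proof.
apply: (iffP idP) => [le_n | [p [le_p Ep lp]]].
  have [p0 Ep0 lp0] := connectP (E_conn x y).
  (* A walk without repeated vertices has length less than [#|V|], so the search in [dist]
     succeeds. *)
  case/shortenP: Ep0 lp0 => p Ep Up _ lp.
  have szp : size p < #|V|.
    by have := card_uniqP Up; rewrite /= => <-; apply: max_card.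
  have hasw : has (fun n => walk E n x y) (iota 0 #|V|).
    apply/hasP; exists (size p); first by rewrite mem_iota.
    by apply/existsP; exists (in_tuple p); rewrite Ep /= lp eqxx.
  have := nth_find 0 hasw; rewrite nth_iota ?add0n; last first.
    by rewrite -[X in _ < X](size_iota 0) -has_find.
  case/existsP=> q /andP[Eq /eqP lq]; exists q; split=> //.
  by rewrite size_tuple.
apply: leq_trans le_p.
have [szp | szp] := ltnP (size p) #|V|; last first.
  by apply: leq_trans szp; rewrite -[X in _ <= X](size_iota 0) find_size.
rewrite leqNgt; apply/negP => lt_p.
have := before_find 0 lt_p; rewrite nth_iota // add0n => /existsP[].
by exists (in_tuple p); rewrite Ep /= lp eqxx.
Qed.

Lemma dist_refl x : dist E x x = 0.
Proof. by apply/eqP; rewrite -leqn0; apply/dist_leP; exists [::]. Qed.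

Lemma dist_edge x y : E x y -> dist E x y <= 1.
Proof. by move=> Exy; apply/dist_leP; exists [:: y]; rewrite /= Exy. Qed.

Lemma dist_triangle y x z : dist E x z <= dist E x y + dist E y z.
Proof.
have /dist_leP[p [szp Ep lp]] := leqnn (dist E x y).
have /dist_leP[q [szq Eq lq]] := leqnn (dist E y z).
apply/dist_leP; exists (p ++ q).
by rewrite size_cat leq_add // cat_path last_cat lp Ep.
Qed.

Lemma dist_le_sym x y n : dist E x y <= n -> dist E y x <= n.
Proof.
case/dist_leP=> p [szp Ep <-]; apply/dist_leP; exists (rev (belast x p)).
rewrite size_rev size_belast rev_path; split=> //.
  by rewrite (eq_path (e' := E)) // => u v; rewrite E_sym.
by case: p {szp Ep} => //= u p; rewrite rev_cons last_rcons.
Qed.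

Lemma dist_sym x y : dist E x y = dist E y x.
Proof. by apply/eqP; rewrite eqn_leq; apply/andP; split; apply: dist_le_sym. Qed.

(** A walk of length at most [r + s + 1] is cut after [r] steps; the next edge accounts for the
    extra 1. If the walk has at most [r] edges, both vertices are [y]. *)
Lemma dist_split x y r s : dist E x y <= r + s + 1 ->
  exists u v, [/\ dist E x u <= r, dist E y v <= s & (u == v) || E u v].
Proof.
case/dist_leP=> p [szp Ep lp].
have [le_pr | lt_rp] := leqP (size p) r.
  exists y, y; rewrite dist_refl eqxx; split=> //.
  by apply/dist_leP; exists p.
have szt : size (take r p) = r by rewrite size_takel // ltnW.
move: Ep lp szp; rewrite -(cat_take_drop r p) cat_path last_cat size_cat szt.
set a := take r p in szt *.
case def_q: (drop r p) => [|z q] /=.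
  by move: lt_rp; rewrite -subn_gt0 -size_drop def_q.
case/and3P=> Ea Ez Eq lq szq; exists (last x a), z; rewrite Ez orbT; split=> //.
  by apply/dist_leP; exists a; rewrite szt.
by apply: dist_le_sym; apply/dist_leP; exists q; split=> //; lia.
Qed.

End Distance.

(** * Perfect elimination orders of chordal graphs *)

Section EliminationOrder.
Variables (V : finType) (E : rel V).
Hypotheses (E_sym : symmetric E) (E_irr : irreflexive E) (E_chord : chordal E).

(* A shortest such walk, closed up through x, would be an induced cycle. *)
Lemma no_avoiding_walk x a b n (w : nat -> V) :
    E x a -> E x b -> a != b -> ~~ E a b -> w 0 = a -> w n = b ->
    (forall k, k < n -> E (w k) (w k.+1)) ->
    (forall k, 0 < k < n -> (w k != x) && ~~ E x (w k)) ->
  False.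
Proof.
move=> Exa Exb neq_ab nEab.
elim/ltn_ind: n w => n IHn w w0 wn Ew wx.
have n_gt1 : 1 < n.
  case: n {IHn wx} wn Ew => [|[|n]] // wn Ew.
    by rewrite -w0 wn eqxx in neq_ab.
  by have := Ew 0 isT; rewrite w0 wn (negPf nEab).
(* Between two occurrences of a vertex the walk can be cut out, which leaves a shorter walk of the
   same kind; a chord gives a similar shortcut below. *)
have inj_w i j : i < j <= n -> w i != w j.
  move=> /andP[lt_ij le_jn]; apply/eqP => eq_w.
  pose w' k := if k <= i then w k else w (k + (j - i)).
  apply: (IHn (n - (j - i)) _ w'); first lia.
  - by rewrite /w'.
  - rewrite /w'; case: leqP => [le_ni|_]; last by rewrite subnK //; lia.
    have -> : n - (j - i) = i by lia.
    by rewrite eq_w -wn; congr w; lia.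
  - move=> k lt_k; rewrite /w'; case: ltngtP => [lt_ki|lt_ik|eq_ki].
    + by apply: Ew; lia.
    + by rewrite addSn; apply: Ew; lia.
    + rewrite eq_ki eq_w; have -> : i.+1 + (j - i) = j.+1 by lia.
      by apply: Ew; lia.
  - by move=> k lt_k; rewrite /w'; case: leqP => ?; apply: wx; lia.
have ind_w i j : i.+1 < j <= n -> ~~ E (w i) (w j).
  move=> /andP[lt_ij le_jn]; apply/negP => Eij.
  pose w' k := if k <= i then w k else w (k + (j - i.+1)).
  apply: (IHn (n - (j - i.+1)) _ w'); first lia.
  - by rewrite /w'.
  - by rewrite /w'; case: leqP => [le_ni|_]; [lia | rewrite subnK //; lia].
  - move=> k lt_k; rewrite /w'; case: ltngtP => [lt_ki|lt_ik|eq_ki].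
    + by apply: Ew; lia.
    + by rewrite addSn; apply: Ew; lia.
    + rewrite eq_ki; have -> : i.+1 + (j - i.+1) = j by lia.
      by [].
  - by move=> k lt_k; rewrite /w'; case: leqP => ?; apply: wx; lia.
have neq_wx k : k <= n -> w k != x.
  move=> le_kn; have [k0 | k_gt0] := posnP k.
    by rewrite k0 w0; apply: contraTneq Exa => ->; rewrite E_irr.
  move: le_kn; rewrite leq_eqVlt => /predU1P[-> | lt_kn].
    by rewrite wn; apply: contraTneq Exb => ->; rewrite E_irr.
  by have /wx/andP[] : 0 < k < n by rewrite k_gt0.
have Exw k : k <= n -> E x (w k) = (k == 0) || (k == n).
  move=> le_kn; have [-> | k_gt0] := posnP k; first by rewrite w0 Exa.
  move: le_kn; rewrite leq_eqVlt => /predU1P[-> | lt_kn].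
    by rewrite wn Exb eqxx orbT.
  have /wx/andP[_ /negPf->] : 0 < k < n by rewrite k_gt0.
  by rewrite ltn_eqF // gtn_eqF.
have Eww i j : i < j <= n -> E (w i) (w j) = (j == i.+1).
  move=> /andP[lt_ij le_jn]; have [-> | neq] := eqVneq j i.+1.
    by apply: Ew; lia.
  by apply/negbTE/ind_w; lia.
(* The walk has [n.+1] vertices and [x] closes it up, so the cycle has length [n.+2], at least 4 by
   [n_gt1]. *)
pose c (i : 'I_n.+2) := if i <= n then w i else x.
apply: (E_chord (n := n.+2) (c := c)); first lia.
have ordSE (i : 'I_n.+2) : val (ordS i) = if i <= n then i.+1 else 0.
  case: i => i /= lt_i; case: leqP => le_i; first by rewrite modn_small //; lia.
  have -> : i = n.+1 by lia.
  exact: modnn.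
have sym_cond (i j : 'I_n.+2) :
   (E (c i) (c j) = (j == ordS i) || (i == ordS j)) ->
   (E (c j) (c i) = (i == ordS j) || (j == ordS i)).
  by rewrite E_sym orbC.
suff cP (i j : 'I_n.+2) : i < j -> c i != c j /\
   E (c i) (c j) = (j == ordS i) || (i == ordS j).
  split=> [i j eq_c | i j].
    apply/val_inj; case: (ltngtP i j) => // lt_ij.
      by have [] := cP _ _ lt_ij; rewrite eq_c eqxx.
    by have [] := cP _ _ lt_ij; rewrite eq_c eqxx.
  case: (ltngtP i j) => [lt_ij | lt_ji | /val_inj <-].
  - by have [] := cP _ _ lt_ij.
  - by apply: sym_cond; have [] := cP _ _ lt_ji.
  rewrite E_irr orbb -val_eqE ordSE /=.
  by case: leqP; lia.
move=> lt_ij; rewrite -!val_eqE !ordSE /c /=.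
have lt_j := ltn_ord j; have le_i : i <= n by rewrite -ltnS (leq_trans lt_ij).
rewrite le_i.
case: leqP => le_j.
  by rewrite inj_w ?Eww ?lt_ij //; split=> //=; lia.
by rewrite neq_wx ?[E _ x]E_sym ?Exw //=; split=> //; lia.
Qed.

Definition simplicial (S : {set V}) s :=
  s \in S /\ {in S &, forall u v, E s u -> E s v -> u != v -> E u v}.

(* Dirac's theorem, by induction on S: take the component C of y in
   S minus N[x] and the set N of its neighbours in N(x), which is a clique, and
   look for a vertex of C that is simplicial in C :|: N. *)
Lemma simplicial_far (S : {set V}) x y :
  x \in S -> y \in S -> y != x -> ~~ E x y ->
  exists s, [/\ simplicial S s, s != x & ~~ E x s].
Proof.
have [m] := ubnP #|S|; elim: m S x y => // m IHm S x y ltSm xS yS neq_yx nExy.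
pose D := [set v in S | (v != x) && ~~ E x v].
pose e := [rel u v | [&& E u v, u \in D & v \in D]].
pose C := [set v | connect e y v].
have yD : y \in D by rewrite inE yS neq_yx.
have CD v : v \in C -> v \in D.
  rewrite inE => /connectP[p]; elim/last_ind: p => [|p z _]; first by move=> _ ->.
  by rewrite rcons_path last_rcons => /andP[_ /and3P[_ _ zD]] ->.
pose N := [set v in S | E x v && [exists c in C, E v c]].
have e_sym : connect_sym e.
  by apply: sym_connect_sym => u v /=; rewrite E_sym [(u \in D) && _]andbC.
(* Nonadjacent [a] and [b] in [N] would be joined by a walk with its interior in [C], hence outside
   the closed neighbourhood of [x], against [no_avoiding_walk]. *)
have Ncl : {in N &, forall a b, a != b -> E a b}.
  move=> a b; rewrite !inE => /and3P[aS Exa /exists_inP[u uC Eau]].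
  case/and3P=> bS Exb /exists_inP[v vC Ebv] neq_ab; apply/negPn/negP=> nEab.
  have /connectP[p ep lp] : connect e u v.
    move: uC vC; rewrite !inE => uC; apply: connect_trans; by rewrite e_sym.
  pose q := rcons (u :: p) b.
  have Eq : path E a q.
    rewrite /q rcons_path /= Eau -lp [E v b]E_sym Ebv andbT.
    by apply: sub_path ep => ? ? /and3P[].
  have qD z : z \in u :: p -> z \in D.
    have: u \in D by apply: CD.
    elim: p u ep {lp q Eq uC Eau} => [|t p IHp] u /= ep uD; rewrite !inE.
      by move/eqP->; rewrite inE in uD.
    move: ep; case/andP=> /and3P[_ _ tD] ep /predU1P[-> | zt].
      by rewrite inE in uD.
    by have := IHp _ ep tD; rewrite !inE in zt *; apply.
  apply: (@no_avoiding_walk x a b (size q) (nth x (a :: q))) => //.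
  - by rewrite -last_nth /q last_rcons.
  - by apply/pathP.
  - case=> // k; rewrite /q size_rcons => /andP[_ ltk]; rewrite ltnS in ltk.
    have /qD : nth x (a :: q) k.+1 \in u :: p.
      by rewrite [nth _ _ _]/= /q nth_rcons ltk mem_nth.
    by rewrite inE => /andP[].
have nbrC c u : c \in C -> u \in S -> E c u -> (u \in C) || (u \in N).
  move=> cC uS Ecu; have := CD _ cC; rewrite inE => /and3P[_ _ nExc].
  have neq_ux : u != x by apply: contraNneq nExc => <-; rewrite E_sym.
  have [Exu | nExu] := boolP (E x u).
    rewrite orbC inE uS Exu; apply/orP; left; apply/exists_inP.
    by exists c; rewrite // E_sym.
  move: cC; rewrite !inE => cC; rewrite (connect_trans cC) // connect1 //=.
  rewrite Ecu CD ?inE ?uS ?neq_ux //.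
have CS : C \subset S by apply/subsetP=> v /CD; rewrite inE => /andP[].
have NS : N \subset S by apply/subsetP=> v; rewrite inE => /andP[].
have xC : x \notin C by apply/negP=> /CD; rewrite inE eqxx /= andbF.
have xN : x \notin N by rewrite inE E_irr andbF.
have lt_card (S' : {set V}) : S' \subset C :|: N -> #|S'| < m.
  move=> sub; rewrite -ltnS; apply: leq_trans ltSm; rewrite ltnS.
  apply: proper_card; rewrite properE; apply/andP; split.
    by apply: subset_trans sub _; rewrite subUset CS.
  apply/subsetPn; exists x => //; apply/negP=> /(subsetP sub).
  by rewrite inE (negPf xC) (negPf xN).
(* By [nbrC], the neighbours in [S] of a vertex of [C] lie in [C :|: N], so a vertex of [C] that is
   simplicial there is simplicial in [S]. *)
suff [s sC sim] : exists2 s, s \in C & simplicial (C :|: N) s.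
  have := CD _ sC; rewrite inE => /and3P[sS neq_sx nExs]; exists s; split=> //.
  split=> // u v uS vS Esu Esv; case: sim => _; apply=> //.
    by rewrite in_setU (nbrC s).
  by rewrite in_setU (nbrC s).
have yC : y \in C by rewrite inE.
(* If some [z] in [N] misses some [t] in [C], induction gives a simplicial vertex not adjacent to
   [z], which cannot lie in the clique [N]. Otherwise [N] is complete to [C], and a simplicial
   vertex of [C] stays simplicial in [C :|: N]. *)
have [/forall_inP dom | ] :=
    boolP [forall z in N, [forall t in C, E z t]]; last first.
  case/forall_inPn=> z zN /forall_inPn[t tC nEzt].
  have neq_tz : t != z.
    have := CD _ tC; rewrite inE => /and3P[_ _]; apply: contraNneq => ->.
    by move: zN; rewrite inE => /and3P[].
  have [||s [sim neq_sz nEzs]] :=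
      IHm (C :|: N) z t (lt_card _ (subxx _)) _ _ neq_tz nEzt.
  - by rewrite in_setU zN orbT.
  - by rewrite in_setU tC.
  exists s => //; have [] := sim; rewrite in_setU => /orP[// | sN] _.
  by have := Ncl z s zN sN; rewrite eq_sym neq_sz (negPf nEzs) => /(_ isT).
have [s [sC sim]] : exists s, simplicial C s.
  have [/forall_inP clC | ] :=
     boolP [forall u in C, [forall v in C, (u != v) ==> E u v]]; last first.
    case/forall_inPn=> u uC /forall_inPn[v vC]; rewrite negb_imply => /andP[neq nE].
    rewrite eq_sym in neq.
    have [s []] := IHm C u v (lt_card _ (subsetUl _ _)) uC vC neq nE.
    by exists s.
  exists y; split=> // u v uC vC _ _ neq.
  by have /forall_inP/(_ v vC) := clC u uC; rewrite neq.
exists s => //; split; first by rewrite inE sC.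
move=> u v; rewrite !in_setU => /orP[uC | uN] /orP[vC | vN] Esu Esv neq.
- exact: sim.
- by rewrite E_sym; have /forall_inP := dom v vN; apply.
- by have /forall_inP := dom u uN; apply.
- exact: Ncl.
Qed.

Lemma simplicial_exists (S : {set V}) : S != set0 -> exists s, simplicial S s.
Proof.
case/set0Pn=> x xS.
have [/exists_inP[u uS /exists_inP[v vS /andP[neq nE]]] | ] :=
    boolP [exists u in S, exists v in S, (v != u) && ~~ E u v].
  by have [s []] := simplicial_far uS vS neq nE; exists s.
rewrite negb_exists_in => /forall_inP cl; exists x; split=> // u v uS vS _ _ neq.
have := cl u uS; rewrite negb_exists_in => /forall_inP/(_ v vS).
by rewrite eq_sym neq /= negbK.
Qed.

(** A perfect elimination order read backwards: vertices are eliminated from the highest rank down,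
    each one simplicial among those that remain. *)
Definition elimination_order (S : {set V}) (rk : V -> nat) :=
  {in S &, injective rk} /\
  {in S & &, forall i u v, E u i -> E v i -> rk u < rk i -> rk v < rk i ->
     u != v -> E u v}.

(** A simplicial vertex is placed last, and the rest of [S] is ordered by induction. *)
Lemma elimination_order_exists (S : {set V}) :
  exists rk, elimination_order S rk.
Proof.
have [m] := ubnP #|S|; elim: m S => // m IHm S ltSm.
have [-> | S0] := eqVneq S set0.
  by exists (fun _ => 0); split=> [u v|i u v]; rewrite inE.
have [s [sS sim]] := simplicial_exists S0.
have [|rk [inj_rk rkP]] := IHm (S :\ s).
  by move: ltSm; rewrite (cardsD1 s) sS.
pose M := \max_x rk x.
have le_M x : rk x <= M by apply: (leq_bigmax x).
pose rk' x := if x == s then M.+1 else rk x.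
exists rk'; split=> [u v uS vS|i u v iS uS vS]; rewrite /rk'.
  case: eqP => [-> | /eqP us]; case: eqP => [-> | /eqP vs] // eq_rk.
  - by have := le_M v; lia.
  - by have := le_M u; lia.
  - by apply: inj_rk; rewrite // !inE ?us ?vs.
have [-> | is_] := eqVneq i s.
  by rewrite ![E _ s]E_sym => ? ? _ _; apply: sim.
have nlt_i : (M.+1 < rk i) = false by rewrite ltnNge leqW.
case: eqVneq => [_ | us]; first by rewrite nlt_i.
case: eqVneq => [_ | vs]; first by rewrite nlt_i.
by apply: rkP; rewrite !inE ?is_ ?us ?vs.
Qed.

End EliminationOrder.

(** * Subtrees of a rooted forest given by a parent map *)

Section Subtrees.
Variables (V : finType) (rk : V -> nat) (par : V -> V).

(* [S] is closed under parents up to its top node [t]. *)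
Definition subtree (S : {set V}) (t : V) :=
  (t \in S) &&
  [forall (i | i \in S), (i != t) ==> (par i \in S) && (rk (par i) < rk i)].

Lemma subtreeP (S : {set V}) t :
  reflect (t \in S /\ forall i, i \in S -> i != t ->
             par i \in S /\ rk (par i) < rk i)
          (subtree S t).
Proof.
apply: (iffP andP) => [[tS /forall_inP H] | [tS H]]; split=> //.
  by move=> i iS neq; have := H i iS; rewrite neq => /andP.
by apply/forall_inP=> i iS; apply/implyP=> neq; apply/andP; apply: H.
Qed.

Lemma subtree_top_le S t i : subtree S t -> i \in S -> rk t <= rk i.
Proof.
case/subtreeP=> tS St; have [m] := ubnP (rk i); elim: m i => // m IHm i lt_im iS.
have [-> // | neq] := eqVneq i t; have [pS lt_p] := St i iS neq.
by apply: leq_trans (ltnW lt_p); apply: IHm => //; lia.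
Qed.

(** The climb from [i] through parents stays in both sets and reaches [t] before it can leave [S']
    above [t']. *)
Lemma subtree_top_in S t S' t' i :
  subtree S t -> subtree S' t' -> i \in S -> i \in S' -> rk t' <= rk t ->
  t \in S'.
Proof.
move=> St St'; have [m] := ubnP (rk i); elim: m i => // m IHm i lt_im iS iS' le_t.
have [<- // | neq] := eqVneq i t.
have [_ /(_ i iS neq)[pS lt_p]] := subtreeP _ _ St.
(* Otherwise the parent of [i] would be in [S] with rank below [rk t'], hence below the least rank
   [rk t]. *)
have neq' : i != t'.
  by apply/eqP=> eq_i; have := subtree_top_le St pS; rewrite -eq_i in le_t; lia.
have [_ /(_ i iS' neq')[pS' _]] := subtreeP _ _ St'.
by apply: (IHm (par i)) => //; lia.
Qed.

(** If [rk t' <= rk t], then [t] lies in [S'], so paths that climb to [t] continue inside [S'] and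
    [t'] is a top of the union. *)
Lemma subtreeU S t S' t' i :
  subtree S t -> subtree S' t' -> i \in S -> i \in S' ->
  exists t'', subtree (S :|: S') t''.
Proof.
move=> + + + +; wlog le_t : S t S' t' / rk t' <= rk t => [hw|] St St' iS iS'.
  have [le_t | /ltnW le_t] := leqP (rk t') (rk t); first exact: (hw S t S' t').
  by rewrite setUC; apply: (hw S' t' S t).
have tS' := subtree_top_in St St' iS iS' le_t.
exists t'; have [_ H] := subtreeP _ _ St; have [t'S' H'] := subtreeP _ _ St'.
apply/subtreeP; rewrite inE t'S' orbT; split=> // j; rewrite !in_setU.
have [jS' _ neq | jS'] := boolP (j \in S').
  by have [-> ->] := H' j jS' neq; rewrite orbT.
rewrite orbF => jS neq.
by have [|-> ->] := H j jS; first by apply: contraNneq jS' => ->.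
Qed.

End Subtrees.

(** * The clique tree, the subtrees of disks, and the injective hull *)

Section CliqueTree.
Variables (V : finType) (E : rel V).
Hypotheses (E_sym : symmetric E) (E_conn : connected E).
Variable rk : V -> nat.
Hypothesis rk_elim : elimination_order E [set: V] rk.

Definition earlier i u := E u i && (rk u < rk i).

(** The value [i] marks a root; since [subtree] asks for a strict drop in rank, a root can only be a
    top. *)
Definition parent i :=
  if [pick u | earlier i u] is Some u0 then [arg max_(u > u0 | earlier i u) rk u]
  else i.

Lemma parentP i u : earlier i u ->
  earlier i (parent i) /\ rk u <= rk (parent i).
Proof.
rewrite /parent; case: pickP => [u0 eu0 | /(_ u) -> //] eu.
by case: arg_maxnP => // p ep pP; split=> //; apply: pP.
Qed.

Definition bag i : {set V} := [set u | (u == i) || earlier i u].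

Lemma bag_dist i u v : u \in bag i -> v \in bag i -> dist E u v <= 1.
Proof.
have [-> | neq] := eqVneq u v; first by rewrite dist_refl.
rewrite !inE => /predU1P[eu | /andP[Eu ltu]] /predU1P[ev | /andP[Ev ltv]].
- by rewrite eu ev eqxx in neq.
- by apply: dist_edge => //; rewrite eu E_sym.
- by apply: dist_edge => //; rewrite ev.
- by apply: dist_edge => //; case: rk_elim => _ /(_ i u v); apply; rewrite ?inE.
Qed.

Definition nodes u : {set V} := [set i | u \in bag i].

(** If [u] is an earlier neighbour of [i], it is equal or adjacent to [parent i], both being in a
    clique, and it ranks no higher; so [u] is in the bag of [parent i]. *)
Lemma nodes_subtree u : subtree rk parent (nodes u) u.
Proof.
apply/subtreeP; rewrite !inE eqxx; split=> // i; rewrite !inE eq_sym.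
case/predU1P=> [-> | eu _]; first by rewrite eqxx.
have [/andP[Ep ltp] le_p] := parentP eu; split=> //.
case: (eqVneq u (parent i)) => //= neq; have /andP[Eu ltu] := eu.
case: rk_elim => inj_rk /(_ i u (parent i)) elimP.
rewrite /earlier elimP ?inE //= ltn_neqAle le_p andbT.
by apply: contra_neq neq => /inj_rk; apply; rewrite inE.
Qed.

Lemma nodes_meet u v : (u == v) || E u v ->
  exists2 i, i \in nodes u & i \in nodes v.
Proof.
case: eqVneq => [<- _ | neq /= Euv]; first by exists u; rewrite !inE eqxx.
have [lt_uv | lt_vu | eq_rk] := ltngtP (rk u) (rk v).
- by exists v; rewrite !inE ?eqxx // /earlier Euv lt_uv orbT.
- by exists u; rewrite !inE ?eqxx // /earlier E_sym Euv lt_vu orbT.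
- by case/eqP: neq; case: rk_elim => inj_rk _; apply: inj_rk; rewrite ?inE.
Qed.

Definition disk_nodes x r : {set V} :=
  [set i | [exists u in bag i, dist E x u <= r]].

Lemma disk_nodesP x r i :
  reflect (exists2 u, i \in nodes u & dist E x u <= r) (i \in disk_nodes x r).
Proof.
rewrite inE; apply: (iffP exists_inP) => -[u iu le_r]; exists u => //.
  by rewrite inE.
by rewrite inE in iu.
Qed.

Lemma disk_meet x y r s : dist E x y <= r + s + 1 ->
  exists2 i, i \in disk_nodes x r & i \in disk_nodes y s.
Proof.
case/(dist_split E_sym E_conn)=> u [v [le_u le_v /nodes_meet[i iu iv]]].
by exists i; apply/disk_nodesP; [exists u | exists v].
Qed.

(** By induction on the radius: the subtrees [nodes u] with [u] at distance at most [r.+1] are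
    joined one at a time to [disk_nodes x r], which each of them meets. *)
Lemma disk_subtree x r : exists t, subtree rk parent (disk_nodes x r) t.
Proof.
have dist0 u v : dist E u v <= 0 -> v = u.
  by case/(dist_leP E_conn) => -[[_ _ <-] | ? ? []].
have nodes_disk u i s : dist E x u <= s -> i \in nodes u -> i \in disk_nodes x s.
  by move=> le_u iu; apply/disk_nodesP; exists u.
elim: r => [|r [t IHr]].
  exists x; have <- : nodes x = disk_nodes x 0; last exact: nodes_subtree.
  apply/setP=> i; apply/idP/disk_nodesP => [ix | [u iu /dist0 <-] //].
  by exists x; rewrite ?dist_refl.
pose W s := disk_nodes x r :|: \bigcup_(u <- s) nodes u.
pose B := enum [pred u | dist E x u <= r.+1].
have -> : disk_nodes x r.+1 = W B.
  apply/setP=> i; rewrite in_setU /B big_enum; apply/disk_nodesP/orP.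
    by case=> u iu le_u; right; apply/bigcupP; exists u.
  case=> [/disk_nodesP[u iu le_u] | /bigcupP[u le_u iu]]; exists u => //.
  exact: leqW.
suff: forall s, {subset s <= B} -> exists t', subtree rk parent (W s) t'.
  by apply.
elim=> [_ | u s IHs sB]; first by exists t; rewrite /W big_nil setU0.
have [|t' St'] := IHs; first by move=> v vs; apply: sB; rewrite inE vs orbT.
have := sB u (mem_head _ _); rewrite mem_enum inE => le_u.
(* The disk of radius 0 around [u] has node set [nodes u], so [disk_meet] applies with [s] equal to
   0. *)
have [|i iD /disk_nodesP[v iv /dist0 eq_v]] := @disk_meet x u r 0; first lia.
rewrite /W big_cons [nodes u :|: _]setUC setUA -/(W s).
apply: (subtreeU St' (nodes_subtree u) (i := i)); first by rewrite inE iD.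
by rewrite -eq_v.
Qed.

Definition top x r := xchoose (disk_subtree x r).

Lemma topP x r : subtree rk parent (disk_nodes x r) (top x r).
Proof. exact: xchooseP. Qed.

(* When S(f) is nonempty, this is the rank of its top node. *)
Definition level (f : V -> nat) := \max_x rk (top x (f x)).

(** The subtrees for [x] and [y] meet, and the top of the former ranks at least as high as that of
    the latter, so [subtree_top_in] applies. *)
Lemma level_top (f g : V -> nat) x :
    (forall y, dist E x y <= f x + g y + 1) ->
    level g <= rk (top x (f x)) ->
  forall y, top x (f x) \in disk_nodes y (g y).
Proof.
move=> le_fg le_g y; have [i ix iy] := disk_meet (le_fg y).
apply: subtree_top_in (topP _ _) (topP _ _) ix iy _.
by apply: leq_trans le_g; apply: (leq_bigmax y).
Qed.

(** For [y] with [f x + f y] equal to the distance from [x], a route through the bag of [i] has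
    length at most [g x + 1 + f y]. *)
Lemma common_node_le (f g : {ffun V -> nat}) i x :
    extremal E f ->
    (forall x, i \in disk_nodes x (f x)) ->
    (forall x, i \in disk_nodes x (g x)) ->
  f x <= g x + 1.
Proof.
case/andP=> _ /forallP/(_ x)/existsP[y /eqP eq_y] fi gi.
have /disk_nodesP[u ui le_u] := gi x; have /disk_nodesP[v vi le_v] := fi y.
rewrite inE in ui; rewrite inE in vi.
have := bag_dist ui vi.
have := dist_triangle E_conn u x y; have := dist_triangle E_conn v u y.
have := dist_sym E_sym E_conn v y; lia.
Qed.

Lemma sup_dist_leP (f g : V -> nat) n :
  reflect (forall x, f x <= g x + n /\ g x <= f x + n) (sup_dist f g <= n).
Proof.
apply: (iffP (bigmax_leqP _ _ _)) => [H x | H x _].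
  by have := H x isT; lia.
by have := H x; lia.
Qed.

Lemma extremal_sup_dist_le1 (f g : {ffun V -> nat}) x y :
  extremal E f -> sup_dist f g <= 1 -> dist E x y <= f x + g y + 1.
Proof.
case/andP=> /forallP/(_ x)/forallP/(_ y) le_f _ /sup_dist_leP/(_ y).
lia.
Qed.

Lemma hull_chordal : chordal (@hull_adj V E).
Proof.
move=> n c n_ge4 [inj_c adj_c].
case: n n_ge4 c inj_c adj_c => // n n_ge4 c inj_c adj_c.
pose F i : {ffun V -> nat} := val (c i).
have extF i : extremal E (F i) := valP (c i).
have [i0 _ maxF] :=
  @arg_maxnP _ (ord0 : 'I_n.+1) predT (fun i => level (F i)) isT.
pose k := ord_pred i0; have def_i0 : ordS k = i0 by apply: ord_predK.
have near j : hull_adj (c i0) (c j) -> sup_dist (F i0) (F j) <= 1.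
  by move/eqP->.
have adj1 : hull_adj (c i0) (c (ordS i0)) by rewrite adj_c eqxx.
have adj2 : hull_adj (c i0) (c k) by rewrite adj_c def_i0 eqxx orbT.
(* The maximum is attained because [V] is nonempty: otherwise all sup-distances would be 0, against
   [adj1]. *)
have [x def_x] : {x | level (F i0) = rk (top x (F i0 x))}.
  apply: eq_bigmax; apply/card_gt0P; case: (pickP V) => [x _ | V0]; first by exists x.
  by move: adj1; rewrite /hull_adj /sup_dist big_pred0.
set t := top x (F i0 x) in def_x.
have in_nbr j : hull_adj (c i0) (c j) -> forall y, t \in disk_nodes y (F j y).
  move=> adj_j; apply: level_top => [y|]; last by rewrite -/t -def_x; apply: maxF.
  exact: extremal_sup_dist_le1 (near _ adj_j).
have : sup_dist (F (ordS i0)) (F k) <= 1.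
  apply/sup_dist_leP=> y; split; apply: (@common_node_le _ _ t) => //; exact: in_nbr.
have ordS_mod m : 0 < m < 4 -> (k + m) %% n.+1 <> k.
  move=> m_lt; rewrite -[RHS](@modn_small k n.+1) // -[X in _ = X %% _]addn0.
  by move/eqP; rewrite eqn_modDl mod0n modn_small; lia.
have ordS_val (i : 'I_n.+1) m :
    val i = (k + m) %% n.+1 -> val (ordS i) = (k + m.+1) %% n.+1.
  by move=> eq_i; rewrite /= [X in X.+1]eq_i -addn1 modnDml addn1 addnS.
have S2 : val (ordS i0) = (k + 2) %% n.+1.
  by apply: ordS_val; rewrite -def_i0 addn1.
have S3 := ordS_val _ _ S2.
(* The neighbours of [i0] stand at positions [k + 2] and [k]. Sup-distance 1 makes them adjacent on
   the cycle, so a shift by 3 or 1 fixes [k]; sup-distance 0 makes them equal, so a shift by 2 does.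
   Length at least 4 excludes all three. *)
rewrite leq_eqVlt ltnS leqn0 => /orP[|] sup_eq.
  have : hull_adj (c (ordS i0)) (c k) by [].
  rewrite adj_c def_i0 => /orP[/eqP eq_k | /eqP eq_i].
    by apply: (ordS_mod 3); rewrite // -S3 -eq_k.
  have {}eq_i : i0 = k by apply: ordS_inj; rewrite eq_i.
  by apply: (ordS_mod 1); rewrite // addn1 -[RHS]/(val k) -[in RHS]eq_i -def_i0.
have /inj_c eq_k : c (ordS i0) = c k.
  apply/val_inj/ffunP=> y; have /sup_dist_leP/(_ y) : sup_dist (F (ordS i0)) (F k) <= 0.
    by rewrite leqn0.
  by rewrite /F; lia.
by apply: (ordS_mod 2); rewrite // -S2 eq_k.
Qed.

End CliqueTree.

Theorem theorem3 (V : finType) (E : rel V)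
    (E_sym : symmetric E) (E_irr : irreflexive E) (E_conn : connected E) :
  chordal E -> chordal (@hull_adj V E).
Proof.
move=> E_chord.
have [rk rkP] := elimination_order_exists E_sym E_irr E_chord [set: V].
exact: hull_chordal rkP.
Qed.
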